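(* For every cancellative commutative monoid $M$, the following conditions are equivalent. (i) Every submonoid of $M$ is a finite factorization monoid (FFM). (ii) Every undermonoid of $M$ is a finite factorization monoid (FFM).
   Context: All monoids are cancellative and commutative, written additively with identity $0$. $\mathcal U(M)$ is the group of units (invertible elements) of $M$ and $\mathcal G(M)$ is its Grothendieck group; $M$ is identified with its image in $\mathcal G(M)$. For a submonoid $N\subseteq M$, $\mathcal G(N)$ is viewed as the subgroup of $\mathcal G(M)$ generated by $N$. A submonoid $N$ of $M$ is an undermonoid of $M$ if $\mathcal G(N)=\mathcal G(M)$. The reduced monoid is $M_{\mathrm{red}}=M/\mathcal U(M)$ (elements are the cosets $x+\mathcal U(M)$). $\mathcal A(M_{\mathrm{red}})$ is its set of atoms: $x+\mathcal U(M)$ is an atom iff $x\notin\mathcal U(M)$ and every equality $x=y+z+\varepsilon$ with $y,z\in M$, $\varepsilon\in\mathcal U(M)$ forces $y\in\mathcal U(M)$ or $z\in\mathcal U(M)$. The factorization monoid $\mathsf Z(M)$ is the free commutative monoid on $\mathcal A(M_{\mathrm{red}})$, and $\varphi_M:\mathsf Z(M)\to M_{\mathrm{red}}$ is the homomorphism that is the identity on atoms. For $b\in M$, $\mathsf Z_M(b)=\{z\in\mathsf Z(M):\varphi_M(z)=b+\mathcal U(M)\}$. $M$ is a finite factorization monoid (FFM) if $1\le|\mathsf Z_M(b)|<\infty$ for every $b\in M$. *)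

(* Defs.v *)
From HB Require Import structures.
From mathcomp Require Import all_boot all_algebra.
From mathcomp Require Import finmap multiset.
From mathcomp Require Import all_classical.
Set Implicit Arguments.
Unset Strict Implicit.
Unset Printing Implicit Defensive.
Import GRing.Theory.
Local Open Scope ring_scope.
Local Open Scope classical_set_scope.
Local Open Scope quotient_scope.

(* Monoids are [nmodType]s; every type carries a [choiceType] structure
   classically, so this is no restriction. *)

Definition cancellative (M : nmodType) : Prop :=
  forall x y z : M, x + y = x + z -> y = z.

Section Reduced.
Variable M : nmodType.
Implicit Types x y z u : M.

Definition mon_units : set M := [set x | exists y, x + y = 0].

Lemma mon_units0 : mon_units 0. Proof. by exists 0; rewrite addr0. Qed.

Lemma mon_unitsD x y : mon_units x -> mon_units y -> mon_units (x + y).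
Proof. by move=> [a xa] [b yb]; exists (a + b); rewrite addrACA xa yb addr0. Qed.

Definition assoc (x y : M) : bool := `[< exists2 u, mon_units u & y = x + u >].

Lemma assoc_refl : reflexive assoc.
Proof. by move=> x; apply/asboolP; exists 0; [exact: mon_units0 | rewrite addr0]. Qed.

Lemma assoc_imp x y : assoc x y -> assoc y x.
Proof.
move=> /asboolP[u [v uv] ->]; apply/asboolP; exists v.
  by exists u; rewrite addrC.
by rewrite -addrA uv addr0.
Qed.

Lemma assoc_sym : symmetric assoc.
Proof. by move=> x y; apply/idP/idP; exact: assoc_imp. Qed.

Lemma assoc_trans : transitive assoc.
Proof.
move=> y x z /asboolP[u Uu ->] /asboolP[v Uv ->]; apply/asboolP.
by exists (u + v); [exact: mon_unitsD | rewrite addrA].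
Qed.

Canonical assoc_equiv := EquivRel assoc assoc_refl assoc_sym assoc_trans.

Lemma assocD x x' y y' : assoc x x' -> assoc y y' -> assoc (x + y) (x' + y').
Proof.
move=> /asboolP[u Uu ->] /asboolP[v Uv ->]; apply/asboolP.
by exists (u + v); [exact: mon_unitsD | rewrite addrACA].
Qed.

(* The reduced monoid M / U(M): the classes of [assoc] are the cosets x + U(M). *)
Definition reduced := {eq_quot assoc}.

HB.instance Definition _ := Choice.on reduced.
HB.instance Definition _ := EqQuotient.on reduced.

Definition coset (x : M) : reduced := \pi_reduced x.
Definition red_add (a b : reduced) : reduced := coset (repr a + repr b).

Lemma coset_eq x y : coset x = coset y <-> assoc x y.
Proof. by split=> [/eqmodP | /eqmodP]. Qed.

Lemma cosetK : cancel (@repr M reduced) coset.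
Proof. exact: reprK. Qed.

Lemma red_addE x y : red_add (coset x) (coset y) = coset (x + y).
Proof. by apply/coset_eq; apply: assocD; apply/coset_eq; rewrite cosetK. Qed.

Lemma red_addA : associative red_add.
Proof.
by move=> a b c; rewrite -[a]cosetK -[b]cosetK -[c]cosetK !red_addE addrA.
Qed.

Lemma red_addC : commutative red_add.
Proof. by move=> a b; rewrite -[a]cosetK -[b]cosetK !red_addE addrC. Qed.

Lemma red_add0 : left_id (coset 0) red_add.
Proof. by move=> a; rewrite -[a]cosetK red_addE add0r. Qed.

HB.instance Definition _ :=
  GRing.isNmodule.Build reduced red_addA red_addC red_add0.

Lemma cosetD x y : coset (x + y) = coset x + coset y.
Proof. by rewrite -red_addE. Qed.

End Reduced.

Section Factorizations.
Variable M : nmodType.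

Definition atom_rep (x : M) : Prop :=
  ~ mon_units x /\
  forall y z e : M, mon_units e -> x = y + z + e -> mon_units y \/ mon_units z.

Definition red_atoms : set (reduced M) := @coset M @` atom_rep.

Definition red_atom := {a : reduced M | a \in red_atoms}.

(* The free commutative monoid on the atoms: finite multisets under [`+`]. *)
Definition factorization := {mset red_atom}%mset.

Definition phi (z : factorization) : reduced M :=
  \sum_(a <- finsupp z) val a *+ z a.

Lemma phi_mset1 (a : red_atom) : phi [mset a]%mset = val a.
Proof.
rewrite /phi (big_fset_incl _ (B := [fset a]%fset)) ?big_seq_fset1 ?msetnxx //.
  by rewrite finsupp_msetn.
by move=> x; rewrite mem_finsupp negbK => _ /eqP ->.
Qed.

Lemma phiD (y z : factorization) : phi (y `+` z)%mset = phi y + phi z.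
Proof.
pose S := (finsupp y `|` finsupp z `|` finsupp (y `+` z)%mset)%fset.
have E (w : factorization) : (finsupp w `<=` S)%fset ->
    phi w = \sum_(a <- S) val a *+ w a.
  move=> wS; rewrite /phi (big_fset_incl _ wS) // => a _.
  by rewrite mem_finsupp negbK => /eqP ->.
rewrite !E.
- by rewrite -big_split; apply: eq_bigr => a _; rewrite msetE2 mulrnDr.
- by apply/fsubsetP => a az; rewrite !inE az orbT.
- by apply/fsubsetP => a ay; rewrite !inE ay.
- by apply/fsubsetP => a az; rewrite !inE az !orbT.
Qed.

Definition factorizations (b : M) : set factorization :=
  [set z | phi z = coset b].

Definition FFM : Prop :=
  forall b : M, factorizations b !=set0 /\ finite_set (factorizations b).

End Factorizations.

Section Submonoids.
Variables (M : nmodType) (N : addrClosed M).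

Definition submonoid : Type := {x : M | x \in N}.

HB.instance Definition _ := SubChoice.on submonoid.

Lemma submonoid_closed : GRing.nmod_closed (in_mem^~ (mem N)).
Proof. by split=> [|x y Nx Ny]; [exact: rpred0 | exact: rpredD]. Qed.

HB.instance Definition _ :=
  GRing.SubChoice_isSubNmodule.Build M _ submonoid submonoid_closed.

End Submonoids.

Section Grothendieck.
Variable M : nmodType.
Implicit Types p q r : (M * M)%type.

(* (a, b) stands for a - b. The extra summand [k] makes this an equivalence
   relation on any commutative monoid; under cancellation it can be dropped. *)
Definition groth_rel p q : bool :=
  `[< exists k, p.1 + q.2 + k = q.1 + p.2 + k >].

Lemma groth_refl : reflexive groth_rel.
Proof. by move=> p; apply/asboolP; exists 0. Qed.

Lemma groth_sym : symmetric groth_rel.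
Proof. by move=> p q; apply/asboolP/asboolP => -[k e]; exists k. Qed.

Lemma groth_trans : transitive groth_rel.
Proof.
move=> [b1 b2] [a1 a2] [c1 c2] /asboolP[/= k e] /asboolP[/= l f]; apply/asboolP => /=.
exists (b1 + b2 + k + l).
transitivity ((a1 + b2 + k) + (b1 + c2 + l)).
  by rewrite (AC (2*4) ((1*4*5)*(3*2*6))).
by rewrite e f (AC (3*3) ((4*2)*(1*5*3*6))).
Qed.

Canonical groth_equiv := EquivRel groth_rel groth_refl groth_sym groth_trans.

Definition groth := {eq_quot groth_rel}.

HB.instance Definition _ := Choice.on groth.
HB.instance Definition _ := EqQuotient.on groth.

Definition groth_class p : groth := \pi_groth p.
Definition groth_add (a b : groth) : groth := groth_class (repr a + repr b).
Definition groth_opp (a : groth) : groth :=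
  groth_class ((repr a).2, (repr a).1).

Lemma groth_eq p q : groth_class p = groth_class q <-> groth_rel p q.
Proof. by split=> [/eqmodP | /eqmodP]. Qed.

Lemma groth_classK : cancel (@repr (M * M)%type groth) groth_class.
Proof. exact: reprK. Qed.

Lemma groth_repr p : groth_rel (repr (groth_class p)) p.
Proof. by apply/groth_eq; rewrite groth_classK. Qed.

Lemma groth_addE p q :
  groth_add (groth_class p) (groth_class q) = groth_class (p + q).
Proof.
apply/groth_eq/asboolP; move: (groth_repr p) (groth_repr q).
move=> /asboolP[k e] /asboolP[l f]; exists (k + l) => /=.
move: e f; set a := (repr _).1; set b := (repr _).2.
set c := (repr _).1; set d := (repr _).2 => e f.
transitivity ((a + p.2 + k) + (c + q.2 + l)).
  by rewrite (AC (2*2*2) ((1*3*5)*(2*4*6))).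
by rewrite e f (AC (3*3) ((1*4)*(2*5)*(3*6))).
Qed.

Lemma groth_oppE p : groth_opp (groth_class p) = groth_class (p.2, p.1).
Proof.
apply/groth_eq/asboolP; move: (groth_repr p) => /asboolP[k e]; exists k => /=.
by rewrite (addrC _ p.1) -e (addrC p.2).
Qed.

Lemma groth_addA : associative groth_add.
Proof.
by move=> a b c; rewrite -[a]groth_classK -[b]groth_classK -[c]groth_classK !groth_addE addrA.
Qed.

Lemma groth_addC : commutative groth_add.
Proof. by move=> a b; rewrite -[a]groth_classK -[b]groth_classK !groth_addE addrC. Qed.

Lemma groth_add0 : left_id (groth_class 0) groth_add.
Proof. by move=> a; rewrite -[a]groth_classK groth_addE add0r. Qed.

Lemma groth_addN : left_inverse (groth_class 0) groth_opp groth_add.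
Proof.
move=> a; rewrite -[a]groth_classK groth_oppE groth_addE.
by apply/groth_eq/asboolP; exists 0 => /=; rewrite !addr0 add0r addrC.
Qed.

HB.instance Definition _ :=
  GRing.isZmodule.Build groth groth_addA groth_addC groth_add0 groth_addN.

Definition groth_inj (x : M) : groth := groth_class (x, 0).

Lemma groth_injD x y : groth_inj (x + y) = groth_inj x + groth_inj y.
Proof.
have -> : groth_inj x + groth_inj y = groth_class ((x, 0) + (y, 0)).
  exact: groth_addE.
by apply/groth_eq/asboolP; exists 0; rewrite /= !addr0.
Qed.

Lemma groth_inj_injective : cancellative M -> injective groth_inj.
Proof.
move=> cM x y /groth_eq/asboolP[k /=]; rewrite !addr0 !(addrC _ k).
exact: cM.
Qed.

Definition generated_subgroup (S : set groth) : set groth :=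
  smallest (fun H : set groth => GRing.zmod_closed (fun a => a \in H)) S.

Definition groth_sub (N : addrClosed M) : set groth :=
  generated_subgroup (groth_inj @` [set` N]).

Definition undermonoid (N : addrClosed M) : Prop := groth_sub N = [set: groth].

End Grothendieck.

(* Main.v *)
Require Import Defs.
From mathcomp Require Import all_boot all_algebra.
From HB Require Import structures.
From mathcomp Require Import finmap multiset all_classical.
Set Implicit Arguments.
Unset Strict Implicit.
Unset Printing Implicit Defensive.
Import GRing.Theory.
Local Open Scope ring_scope.
Local Open Scope classical_set_scope.

(**
Only the passage from undermonoids to submonoids needs an argument, and it
rests on two facts.

First, a cancellative monoid is an FFM exactly when each element has finitely
many divisors up to units ([FFM_finite_divisors], [finite_divisors_FFM]).  This
makes the FFM property descend from a monoid to a submonoid that has the same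
units, since there two elements associated in the larger monoid are already
associated in the smaller one ([FFM_submonoid]).

Second, every submonoid N that is not a group lies in an undermonoid with the
same units.  By Zorn's lemma there is a maximal submonoid S containing N all of
whose units lie in N ([maximal_unit_extension]).  Let U be the group of units
of S, let n be an element of S \ U, and let x be in M.  The set made of S and of
all s + k x, with s in S \ U and k a natural number, is a submonoid, and its
units are those of S unless s + m x = 0 for some s in S \ U and m > 0.  In that
case x is invertible in M, and the same construction with -x in place of x
creates no unit: otherwise t - l x = 0 with t in S \ U and l > 0, and then
l s + m t = 0, which makes s a unit of S.  By maximality S contains n + x or n - x
([maximal_extension_shift]), so x or -x is a difference of elements of S, and
S generates the whole Grothendieck group ([undermonoid_shift]).

An undermonoid S that is an FFM thus makes N an FFM; and a submonoid N that is
a group is an FFM because its reduced monoid is trivial.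
*)

(** * The reduced monoid *)

Section ReducedTheory.
Variable M : nmodType.
Implicit Types (x y : M) (a b r s : reduced M).

Lemma coset_onto r : exists x, r = coset x.
Proof. by exists (repr r); rewrite cosetK. Qed.

Lemma coset_eq0 x : coset x = 0 <-> mon_units x.
Proof.
split=> [/esym/coset_eq/asboolP[u Uu]|Ux]; first by rewrite add0r => ->.
by apply/esym/coset_eq/asboolP; exists x; rewrite ?add0r.
Qed.

Lemma mon_unitsDl x y : mon_units (x + y) -> mon_units x.
Proof. by move=> [z xyz0]; exists (y + z); rewrite addrA. Qed.

Lemma reduced_addl_eq0 r s : r + s = 0 -> r = 0.
Proof.
have [[x ->] [y ->]] := (coset_onto r, coset_onto s).
by rewrite -cosetD => /coset_eq0/mon_unitsDl/coset_eq0.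
Qed.

Lemma reduced_cancellative : cancellative M -> cancellative (reduced M).
Proof.
move=> cM r s t; have [x ->] := coset_onto r.
have [[y ->] [z ->]] := (coset_onto s, coset_onto t).
rewrite -!cosetD => /coset_eq/asboolP[u Uu]; rewrite -addrA => /cM ->.
by apply/coset_eq/asboolP; exists u.
Qed.

(** Modulo units the unit [e] in the definition of an atom disappears, so that
    atoms can be handled inside the reduced monoid alone. *)
Lemma red_atomsP a :
  a \in @red_atoms M <->
  a <> 0 /\ forall r s, a = r + s -> r = 0 \/ s = 0.
Proof.
split=> [/set_mem[x [nUx xP] <-]|[a0 aP]].
  split=> [/coset_eq0 //|r s].
  have [[y ->] [z ->]] := (coset_onto r, coset_onto s).
  rewrite -cosetD => /esym/coset_eq/asboolP[u Uu /xP[] //].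
    by left; apply/coset_eq0.
  by right; apply/coset_eq0.
have [x xa] := coset_onto a; rewrite {a}xa in a0 aP *.
apply: mem_set; exists x => //; split=> [/coset_eq0 //|y z e Ue xE].
have /aP[] : coset x = coset y + coset z.
  by rewrite -cosetD xE cosetD (coset_eq0 e).2 // addr0.
  by move=> /coset_eq0; left.
by move=> /coset_eq0; right.
Qed.

End ReducedTheory.

(** * Finite factorization and finiteness of divisors *)

Definition divisor_set (R : nmodType) (b : R) : set R := [set x | exists y, x + y = b].

(** Submultisets of [w] are the multisets of the subsequences of a listing of
    [w], and these are indexed by bit masks. *)
Lemma finite_msubsets (K : choiceType) (w : {mset K}%mset) :
  finite_set [set z | (z `<=` w)%mset].
Proof.
pose f (m : (size w).-tuple bool) : {mset K}%mset := seq_mset (mask m w).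
apply: (@sub_finite_set _ _ (f @` setT)); last exact: finite_image.
move=> z /= /msubsetP zw.
have /count_subseqP[s /subseqP[m sz_m ->] zs] :
    forall x, (count_mem x z <= count_mem x w)%N.
  by move=> x; rewrite !count_mem_mset.
exists (Tuple (introT eqP sz_m)) => //; rewrite -[RHS]seq_mset_id.
by apply/esym/eq_seq_msetP.
Qed.

Section FiniteFactorization.
Variable M : nmodType.
Implicit Types (b r : reduced M) (z w : factorization M).

Definition finitely_many_divisors := forall b, finite_set (divisor_set b).

Lemma phi0 : phi (mset0 : factorization M) = 0.
Proof.
by rewrite /phi big1_seq // => a _; rewrite mset0E.
Qed.

(** A factorization of a divisor of [b] extends, by one of the complementary
    summand, to a factorization of [b].  So each divisor is the value of a
    submultiset of one of the finitely many factorizations of [b]. *)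
Lemma FFM_finite_divisors : FFM M -> finitely_many_divisors.
Proof.
move=> ffM b; have [x bx] := coset_onto b.
pose below w := [set z : factorization M | (z `<=` w)%mset].
have [_ finZ] := ffM x.
apply: (@sub_finite_set _ _ (@phi M @` \bigcup_(w in factorizations x) below w)).
  move=> r [s rsb]; have [[y ry] [t st]] := (coset_onto r, coset_onto s).
  have [[z zP] _] := ffM y; have [[w wP] _] := ffM t.
  exists z; last by rewrite zP.
  exists (z `+` w)%mset; first by rewrite /factorizations /= phiD zP wP -ry -st rsb.
  by apply/msubsetP => a; rewrite msetE2 leq_addr.
by apply: finite_image; apply: bigcup_finite => // w _; exact: finite_msubsets.
Qed.

Hypothesis cM : cancellative M.
Hypothesis finD : finitely_many_divisors.

(* The number of divisors strictly decreases when a nonzero summand is removed;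
   it is the measure for both inductions below. *)
Let ndiv b := #|` fset_set (divisor_set b)|.

(** The divisor [r + b] of itself does not divide [b]: by cancellation [r] would
    divide 0, and the reduced monoid has no nonzero unit. *)
Lemma ndiv_ltDr r b : r <> 0 -> (ndiv b < ndiv (r + b)%R)%N.
Proof.
move=> r0; have cR := reduced_cancellative cM.
apply: fproper_ltn_card; rewrite fproperE; apply/andP; split.
  apply/fsubsetP => s; rewrite !in_fset_set // => /set_mem[t <-]; apply/mem_set.
  by exists (r + t); rewrite addrCA.
apply/fsubsetPn; exists (r + b); rewrite in_fset_set //.
  by apply/mem_set; exists 0; rewrite addr0.
apply/negP => /set_mem[s]; rewrite -addrA addrCA -[RHS]addr0 => /cR.
by move/reduced_addl_eq0.
Qed.

Lemma phi_cons (a : red_atom M) z : phi (a +` z)%mset = val a + phi z.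
Proof. by rewrite phiD phi_mset1. Qed.

Lemma val_red_atom_neq0 (a : red_atom M) : val a <> 0.
Proof. by have /red_atomsP[] := valP a. Qed.

Lemma factorization_exists b : exists z, phi z = b.
Proof.
have [n] := ubnP (ndiv b); elim: n => // n IHn in b *; rewrite ltnS => le_bn.
have [->|/eqP b0] := eqVneq b 0; first by exists mset0; exact: phi0.
have [ab|nab] := boolP (b \in @red_atoms M).
  by exists [mset (exist _ b ab : red_atom M)]%mset; rewrite phi_mset1.
(* [b] is neither zero nor an atom, so it splits into two nonzero summands. *)
have [r [s [bE r0 s0]]] : exists r s, [/\ b = r + s, r <> 0 & s <> 0].
  apply: contrapT => noE; move/negP: nab; apply; apply/red_atomsP; split=> // r s bE.
  have [r0|/eqP r0] := eqVneq r 0; [by left | right].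
  by apply: contrapT => s0; apply: noE; exists r, s.
have [z zP] : exists z, phi z = r.
  by apply: IHn; apply: leq_trans le_bn; rewrite bE addrC ndiv_ltDr.
have [w wP] : exists w, phi w = s.
  by apply: IHn; apply: leq_trans le_bn; rewrite bE ndiv_ltDr.
by exists (z `+` w)%mset; rewrite phiD zP wP.
Qed.

(** A nonempty factorization of [b] consists of an atom dividing [b] and of a
    factorization of the complement, which has fewer divisors than [b]. *)
Lemma finite_phi_fiber b : finite_set [set z | phi z = b].
Proof.
have [n] := ubnP (ndiv b); elim: n => // n IHn in b *; rewrite ltnS => le_bn.
(* The factorizations of [b] in which the atom [r] occurs. *)
pose F r := [set z | exists a w, [/\ val a = r, r + phi w = b & z = (a +` w)%mset]].
apply: (@sub_finite_set _ _ ([set mset0] `|` \bigcup_(r in divisor_set b) F r)).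
  move=> z /= zb; have [->|[a az]] := mset_0Vmem z; [by left | right].
  have zE := msetB1K az; exists (val a).
    by exists (phi (z `\ a)%mset); rewrite -phi_cons zE.
  by exists a, (z `\ a)%mset; rewrite -phi_cons zE.
rewrite finite_setU; split; first exact: finite_set1.
apply: bigcup_finite => // r _.
have [[[a w] [/= aE wE]]|noF] :=
    pselect (exists p : red_atom M * factorization M, val p.1 = r /\ r + phi p.2 = b).
  have fin_w : finite_set [set z | phi z = phi w].
    apply: IHn; apply: leq_trans le_bn; rewrite -wE; apply: ndiv_ltDr.
    by rewrite -aE; exact: val_red_atom_neq0.
  apply: sub_finite_set (finite_image (fun z => a +` z)%mset fin_w) => z.
  move=> [a' [w' [aE' wE' ->]]]; exists w' => /=.
    by apply: (reduced_cancellative cM (x := r)); rewrite wE'.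
  by have -> : a = a' by apply: val_inj; exact: etrans aE (esym aE').
apply: (@sub_finite_set _ _ set0) => // z [a [w [aE wE _]]].
by apply: noF; exists (a, w).
Qed.

Lemma finite_divisors_FFM : FFM M.
Proof.
move=> b; split; last exact: finite_phi_fiber.
by have [z zb] := factorization_exists (coset b); exists z.
Qed.

End FiniteFactorization.

(** * Passing to a submonoid with the same units *)

(** An injective morphism whose image contains all units of [L] identifies no
    two cosets of units of [K], hence embeds [reduced K] in [reduced L], and
    carries divisors to divisors. *)
Lemma finite_divisors_transfer (K L : nmodType) (f : K -> L) :
    f 0 = 0 -> {morph f : x y / x + y} -> injective f ->
    (forall u, mon_units u -> exists w, f w = u) ->
  finitely_many_divisors L -> finitely_many_divisors K.
Proof.
move=> f0 fD f_inj f_units finL b.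
pose j (r : reduced K) := coset (f (repr r)).
have jE x : j (coset x) = coset (f x).
  have := cosetK (coset x); rewrite /j; move: (repr _) => y.
  move=> /coset_eq/asboolP[u [v uv0] ->].
  apply/coset_eq/asboolP; exists (f u); last exact: fD.
  by exists (f v); rewrite -fD uv0.
have j_inj : injective j.
  move=> r s; have [[x ->] [y ->]] := (coset_onto r, coset_onto s).
  rewrite !jE => /coset_eq/asboolP[u Uu].
  have [w wu] := f_units _ Uu; have [v uv0] := Uu.
  have [|w' w'v] := f_units v; first by exists u; rewrite addrC.
  rewrite -wu -fD => /f_inj ->; apply/coset_eq/asboolP; exists w => //.
  by exists w'; apply: f_inj; rewrite fD wu w'v uv0.
apply: sub_finite_set (finite_preimage (in2W j_inj) (finL (j b))) => r [s <-].
have [[x ->] [y ->]] := (coset_onto r, coset_onto s).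
by exists (j (coset y)); rewrite -cosetD !jE fD cosetD.
Qed.

Section Submonoids.
Variable M : nmodType.
Hypothesis cM : cancellative M.

Lemma submonoid_cancellative (N : addrClosed M) : cancellative (submonoid N).
Proof. by move=> x y z /(congr1 val); rewrite !raddfD /= => /cM/val_inj. Qed.

Lemma FFM_submonoid (N T : addrClosed M) :
    {subset N <= T} -> (forall x y, x \in T -> y \in T -> x + y = 0 -> x \in N) ->
  FFM (submonoid T) -> FFM (submonoid N).
Proof.
move=> NT unitsTN /FFM_finite_divisors finT.
apply: finite_divisors_FFM; first exact: submonoid_cancellative.
pose f (x : submonoid N) : submonoid T := exist _ (val x) (NT _ (valP x)).
apply: (@finite_divisors_transfer _ _ f) finT.
- exact: val_inj.
- by move=> x y; exact: val_inj.
- by move=> x y /(congr1 val)/= /val_inj.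
move=> u [v /(congr1 val)]; rewrite raddfD /= => uv0.
have uN := unitsTN _ _ (valP u) (valP v) uv0.
by exists (exist _ (val u) uN); exact: val_inj.
Qed.

(** Plain sets closed under addition are used for the maximality argument,
    which takes unions of chains; [pack_submonoid] turns the result into a
    bundled submonoid. *)
Definition is_submonoid (A : set M) : Prop :=
  A 0 /\ forall x y, A x -> A y -> A (x + y).

Definition mem_pred_of (A : set M) : {pred M} := fun x => `[< A x >].

Lemma is_submonoid_closed A : is_submonoid A -> GRing.nmod_closed (mem_pred_of A).
Proof.
move=> [A0 AD]; split=> [|x y]; first exact/asboolP.
by move=> /asboolP Ax /asboolP Ay; apply/asboolP; exact: AD.
Qed.

Definition pack_submonoid A (subA : is_submonoid A) : addrClosed M :=
  HB.pack (mem_pred_of A)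
    (GRing.isAddClosed.Build M (mem_pred_of A) (is_submonoid_closed subA)).

(* same units *)
(** * Maximal extensions without new units *)

(** The last clause says that the units of [A] lie in [N]; their inverses in
    [A] do too, by symmetry, so [A] and [N] have the same units. *)
Definition unit_extension (N A : set M) :=
  [/\ is_submonoid A, N `<=` A & forall x y, A x -> A y -> x + y = 0 -> N x].

(** A unit of the union of a chain is, with its inverse, already in one member,
    so the condition passes to unions of chains. *)
Lemma maximal_unit_extension (N : set M) : is_submonoid N ->
  exists2 S, unit_extension N S &
    forall T, unit_extension N T -> S `<=` T -> T `<=` S.
Proof.
move=> [N0 ND].
(* Taking [N `|` A] instead of [A] lets the empty chain satisfy the condition. *)
have [F FP totF|S [extS maxS]] := @Zorn_bigcup _ [set A | unit_extension N (N `|` A)].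
  (* Closure and units involve two elements at a time, and these lie in [N] or
     in a common [N `|` A]. *)
  have pairF x y : (N `|` \bigcup_(X in F) X) x -> (N `|` \bigcup_(X in F) X) y ->
      (N x /\ N y) \/ exists2 A, F A & (N `|` A) x /\ (N `|` A) y.
    move=> [Nx|[A FA Ax]] [Ny|[B FB By]]; [by left|right..].
    - by exists B => //; split; [left | right].
    - by exists A => //; split; [right | left].
    have [AB|BA] := totF _ _ FA FB.
      by exists B => //; split; right => //; exact: AB.
    by exists A => //; split; right => //; exact: BA.
  split; [split; first by left| by left|].
    move=> x y xF yF; have [[Nx Ny]|[A FA [Ax Ay]]] := pairF x y xF yF.
      by left; exact: ND.
    have [[_ AD] _ _] := FP _ FA.
    by have [|?] := AD x y Ax Ay; [left | right; exists A].
  move=> x y xF yF xy0; have [[]//|[A FA [Ax Ay]]] := pairF x y xF yF.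
  by have [_ _ unitsA] := FP _ FA; exact: unitsA xy0.
exists (N `|` S) => // T extT ST; have [_ NT _] := extT.
have /not_andP[] : ~ (S `<=` T /\ ~ T `<=` S).
- by move=> ST'; apply: maxS ST' _; rewrite /= ((setUidPr N T).2 NT).
- by move=> []; apply: subset_trans ST; exact: subsetUr.
by move/contrapT => TS x /TS; right.
Qed.

(** [unit_of S] is meant for submonoids [S]: outside [S] it may contain
    elements of [M] whose inverse is in [S]. *)
Definition unit_of (S : set M) : set M := [set x | exists2 y, S y & x + y = 0].

(** Only nonunits of [S] are allowed in front of multiples of [x].  This keeps
    the new units under control, and still puts [x] in the generated group as
    soon as [S] has a nonunit. *)
Definition adjoin (S : set M) x : set M :=
  S `|` [set z | exists s k, [/\ S s, ~ unit_of S s & z = s + x *+ k]].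

Section Adjoin.
Variable S : set M.
Hypothesis subS : is_submonoid S.

Lemma is_submonoidMn s k : S s -> S (s *+ k).
Proof.
by case: subS => S0 SD Ss; elim: k => [|k IHk]; rewrite ?mulr0n ?mulrS //; exact: SD.
Qed.

Lemma nonunitD s t : ~ unit_of S s -> S t -> ~ unit_of S (s + t).
Proof.
case: subS => _ SD nUs St [y Sy sty0]; apply: nUs.
by exists (t + y); [exact: SD | rewrite addrA].
Qed.

Lemma is_submonoid_adjoin x : is_submonoid (adjoin S x).
Proof.
have [S0 SD] := subS; split; first by left.
move=> a b [Sa|[s [k [Ss nUs ->]]]] [Sb|[t [l [St nUt ->]]]].
- by left; exact: SD.
- right; exists (t + a), l; split; [exact: SD|exact: nonunitD|].
  by rewrite addrCA addrA.
- right; exists (s + b), k; split; [exact: SD|exact: nonunitD|].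
  by rewrite addrAC.
right; exists (s + t), (k + l)%N; split; [exact: SD|exact: nonunitD|].
by rewrite mulrnDr addrACA.
Qed.

(** Two new elements that cancel, or a new one and an old one, sum to
    [s + x *+ m] with [s] a nonunit of [S]; for [m = 0] this cannot vanish. *)
Lemma adjoin_units x :
    (forall s m, S s -> ~ unit_of S s -> s + x *+ m.+1 <> 0) ->
  forall y z, adjoin S x y -> adjoin S x z -> y + z = 0 -> S y /\ S z.
Proof.
move=> noinv; have [S0 SD] := subS.
have main s t k l : S s -> ~ unit_of S s -> S t -> s + x *+ k + (t + x *+ l) <> 0.
  move=> Ss nUs St; rewrite addrACA -mulrnDr; case: (k + l)%N => [|m].
    by rewrite addr0 => st0; apply: nUs; exists t.
  by apply: noinv; [exact: SD | exact: nonunitD].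
move=> a b [Sa|[s [k [Ss nUs ->]]]] [Sb|[t [l [St nUt ->]]]] //.
- by rewrite addrC -[a]addr0 => /(main _ _ _ 0%N St nUt Sa).
- by rewrite -[b]addr0 => /(main _ _ _ 0%N Ss nUs Sb).
by move=> /(main _ _ _ _ Ss nUs St).
Qed.

(** If adjoining [x] creates a unit then [s + x *+ m.+1 = 0] for a nonunit [s],
    so [x] has an inverse [x'].  If adjoining [x'] created one too, with
    [t + x' *+ n.+1 = 0], then adding [n.+1] times the first equation to [m.+1]
    times the second would cancel [x] against [x'] and make [s] a unit. *)
Lemma adjoin_units_or_opp x :
    (forall y z, adjoin S x y -> adjoin S x z -> y + z = 0 -> S y /\ S z) \/
  exists2 x', x + x' = 0 &
    forall y z, adjoin S x' y -> adjoin S x' z -> y + z = 0 -> S y /\ S z.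
Proof.
have [noinv|] := pselect (forall s m, S s -> ~ unit_of S s -> s + x *+ m.+1 <> 0).
  by left; exact: adjoin_units.
move=> /existsNP[s /existsNP[m /not_implyP[Ss /not_implyP[nUs /contrapT sx0]]]].
have [x' xx'0] : exists x', x + x' = 0.
  by exists (s + x *+ m); rewrite addrCA -mulrS.
right; exists x' => //.
apply: adjoin_units => t n St nUt tx'0; apply: nUs.
have [_ SD] := subS.
exists (s *+ n + t *+ m.+1).
  by apply: SD; exact: is_submonoidMn.
rewrite addrA -mulrS.
have -> : s *+ n.+1 + t *+ m.+1 = (s + x *+ m.+1) *+ n.+1 + (t + x' *+ n.+1) *+ m.+1.
  rewrite !mulrnDl addrACA -!mulrnA [(m.+1 * n.+1)%N]mulnC -mulrnDl xx'0.
  by rewrite mul0rn addr0.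
by rewrite sx0 tx'0 !mul0rn addr0.
Qed.

End Adjoin.

(** Maximality makes [S] contain [adjoin S x] or [adjoin S y], for the inverse
    [y] of [x]. *)
Lemma maximal_extension_shift (N S : set M) n x :
    unit_extension N S ->
    (forall T, unit_extension N T -> S `<=` T -> T `<=` S) ->
    S n -> ~ unit_of S n ->
  S (n + x) \/ exists2 y, x + y = 0 & S (n + y).
Proof.
move=> [subS NS unitsS] maxS Sn nUn.
have shift y : (forall a b, adjoin S y a -> adjoin S y b -> a + b = 0 -> S a /\ S b) ->
    S (n + y).
  move=> unitsSy; apply: (maxS (adjoin S y)).
  - split; [exact: is_submonoid_adjoin|by move=> a /NS; left|].
    by move=> a b ya yb ab0; have [Sa Sb] := unitsSy a b ya yb ab0; exact: unitsS ab0.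
  - by move=> a; left.
  by right; exists n, 1%N.
have [/shift|[y xy0 /shift]] := adjoin_units_or_opp subS x; first by left.
by right; exists y.
Qed.

(** * Undermonoids and the equivalence *)

(** Either alternative writes [x] as a difference of elements of [T] in the
    Grothendieck group, and [M] generates that group. *)
Lemma undermonoid_shift (T : addrClosed M) n :
    n \in T ->
    (forall x, n + x \in T \/ exists2 y, x + y = 0 & n + y \in T) ->
  undermonoid T.
Proof.
move=> Tn shift; apply/seteqP; split=> // g _ H [/= [H0 HB] TH].
have inH x : x \in T -> H (groth_inj x) by move=> Tx; apply: TH; exists x.
have {}HB a b : H a -> H b -> H (a - b).
  by move=> /mem_set Ha /mem_set Hb; apply/set_mem; exact: HB.
have Hinj x : H (groth_inj x).
  have [Tnx|[y xy0 Tny]] := shift x.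
    have -> : groth_inj x = groth_inj (n + x) - groth_inj n.
      by rewrite groth_injD addrAC subrr add0r.
    by apply: HB; exact: inH.
  have -> : groth_inj x = groth_inj n - groth_inj (n + y).
    apply/esym/(canLR (addrK _)).
    by rewrite -groth_injD addrCA xy0 addr0.
  by apply: HB; exact: inH.
have [[a b] <-] : exists p, groth_class p = g.
  by exists (repr g); exact: groth_classK.
suff -> : groth_class (a, b) = groth_inj a - groth_inj b by exact: HB.
apply/esym/(canLR (addrK _)).
have -> : groth_class (a, b) + groth_inj b = groth_class ((a, b) + (b, 0)).
  exact: groth_addE.
by apply/groth_eq/asboolP; exists 0; rewrite /= !addr0.
Qed.

End Submonoids.

Lemma group_FFM (K : nmodType) : cancellative K -> (forall x : K, mon_units x) -> FFM K.
Proof.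
move=> cK allU; apply: finite_divisors_FFM => // b.
apply: (@sub_finite_set _ _ [set 0]); last exact: finite_set1.
by move=> r _; have [x ->] := coset_onto r; apply/coset_eq0.
Qed.

Theorem theorem1p2 (M : nmodType) (cM : cancellative M) :
  (forall N : addrClosed M, FFM (submonoid N)) <->
  (forall N : addrClosed M, undermonoid N -> FFM (submonoid N)).
Proof.
split=> [allF N _ //|underF N].
have [allU|/existsNP[n nUn]] := pselect (forall x : submonoid N, mon_units x).
  by apply: group_FFM => //; exact: submonoid_cancellative.
have subN : is_submonoid [set` N].
  by split=> [|x y /= Nx Ny]; [exact: rpred0 | exact: rpredD].
have [S extS maxS] := maximal_unit_extension subN.
have [subS NS unitsS] := extS.
have nUSn : ~ unit_of S (val n).
  move=> [y Sy ny0]; apply: nUn.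
  have Ny : y \in N.
    by apply: (unitsS y (val n)) => //; [exact: NS (valP n) | rewrite addrC].
  by exists (exist _ y Ny); apply: val_inj; rewrite raddfD.
apply: (@FFM_submonoid _ cM _ (pack_submonoid subS)).
- by move=> x Nx; apply/asboolP/NS.
- by move=> x y /asboolP Sx /asboolP Sy; exact: unitsS.
apply: underF; apply: (@undermonoid_shift _ _ (val n)).
  by apply/asboolP; exact: NS (valP n).
move=> x; have [|[y xy0]] := maximal_extension_shift x extS maxS (NS _ (valP n)) nUSn.
  by left; apply/asboolP.
by right; exists y => //; apply/asboolP.
Qed.
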